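(* Let $K\ge1$ and $d\ge1$, and for $k=1,\ldots,K$ let $A_k$ and $B_k$ be positive semidefinite $d\times d$ complex matrices such that $A_kB_k=B_kA_k$ for each $k$. Then \[ \sigma\Big(\sum_{k=1}^K A_kB_k\Big)\prec_w \sigma\Big(\big(\sum_{k=1}^K A_k\big)\big(\sum_{k=1}^K B_k\big)\Big), \] equivalently, for every unitarily invariant norm $|||\cdot|||$ on $d\times d$ matrices, \[ \Big|\Big|\Big|\sum_{k=1}^K A_kB_k\Big|\Big|\Big| \le \Big|\Big|\Big| \big(\sum_{k=1}^K A_k\big)\big(\sum_{k=1}^K B_k\big)\Big|\Big|\Big|. \]
   Context: $\sigma(X)$ denotes the vector of singular values of $X$ sorted in non-increasing order. For real vectors $x,y\in\mathbb{R}^d$, $x\prec_w y$ means $\sum_{i=1}^k x^\downarrow_i\le\sum_{i=1}^k y^\downarrow_i$ for all $k=1,\dots,d$, where $x^\downarrow$ is $x$ sorted non-increasingly. A norm $|||\cdot|||$ is unitarily invariant if $|||UXV|||=|||X|||$ for all unitary $U,V$. *)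

(* Defs.v *)
(* Complex matrices are modelled over an arbitrary
   numClosedFieldType C (e.g. algC). *)
From HB Require Import structures.
From mathcomp Require Import all_boot all_order all_algebra.
Set Implicit Arguments. Unset Strict Implicit. Unset Printing Implicit Defensive.
Import Order.TTheory GRing.Theory Num.Theory.
Local Open Scope ring_scope.
Open Scope sesquilinear_scope.

Section Defs.
Variable C : numClosedFieldType.

(* positive semidefinite: Hermitian and v A v^* >= 0 for every vector v *)
Definition psdmx n (A : 'M[C]_n) : Prop :=
  A \is hermsymmx /\ forall v : 'rV[C]_n, 0 <= (v *m A *m v ^t*) 0 0.

(* eigenvalues with multiplicity: the roots of the characteristic polynomial *)
Definition eigvals n (A : 'M[C]_n) : seq C :=
  sval (closed_field_poly_normal (char_poly A)).

(* non-increasing rearrangement of a (real) vector *)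
Definition sort_dec (s : seq C) : seq C := sort (fun x y => y <= x) s.

(* singular values sorted non-increasingly: square roots of eigenvalues of X^* X *)
Definition singvals n (X : 'M[C]_n) : seq C :=
  sort_dec [seq sqrtC z | z <- eigvals (X ^t* *m X)].

(* weak majorization x <_w y for real vectors of the same length *)
Definition weak_maj (x y : seq C) : Prop :=
  size x = size y /\
  forall k, (k <= size x)%N ->
    \sum_(i < k) (sort_dec x)`_i <= \sum_(i < k) (sort_dec y)`_i.
End Defs.

(* Main.v *)
(* Simultaneous diagonalization gives A_k = R_k R_k^*, B_k = T_k T_k^* with
   X_k = R_k T_k^* positive semidefinite and X_k^2 = A_k B_k.  With X = sum X_k,
   the top-k eigenvalue sums S_k satisfy S_k (sum X_k^2) <= S_k (X^2): iterated
   parallelogram identities average sum X_k^2 over the squares of the signed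
   sums H = sum +-X_k, which satisfy -X <= H <= X, so on orthonormal eigenvectors
   v of H one has |v H v^*|^2 <= |v X v^*|^2 <= v X^2 v^*.
   Next X = R T^* for the block rows R, T of the R_k, T_k, and X shares its
   nonzero eigenvalues with T^* R, whence S_k (X^2) <= S_k (T^* (R R^* ) T) by
   Schur's inequality; T^* (R R^* ) T in turn shares its nonzero eigenvalues with
   (R R^* )(T T^* ) = (sum A_k)(sum B_k), and Ky Fan's inequality bounds their sum
   by the k largest singular values.  A family of m orthonormal vectors is an
   m x n matrix V with V \is unitarymx, that is V V^* = 1. *)
Require Import Defs.
From HB Require Import structures.
From mathcomp Require Import all_boot all_order all_algebra.
From mathcomp Require Import ring.
Import Order.TTheory GRing.Theory Num.Theory.
Local Open Scope ring_scope.

Section SumsOfCommutingPairs.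
Local Set Implicit Arguments.
Local Unset Strict Implicit.
Local Unset Printing Implicit Defensive.
Variable C : numClosedFieldType.

(** * Adjoints, Gram matrices and positive semidefiniteness *)

Lemma adjmxE m n (M : 'M[C]_(m, n)) i j : (M ^t*) i j = (M j i)^*.
Proof. by rewrite !mxE. Qed.

Lemma adjmxM m n p (A : 'M[C]_(m, n)) (B : 'M[C]_(n, p)) :
  (A *m B) ^t* = B ^t* *m A ^t*.
Proof. by rewrite trmx_mul map_mxM. Qed.

Lemma adjmx1 n : (1%:M : 'M[C]_n) ^t* = 1%:M.
Proof. by rewrite trmx1 map_mx1. Qed.

Lemma adj_diag_mx n (w : 'rV[C]_n) : (diag_mx w) ^t* = diag_mx (map_mx Num.conj w).
Proof. by rewrite tr_diag_mx map_diag_mx. Qed.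

Lemma real_diag_mx_adj n (w : 'rV[C]_n) :
  (forall i, w 0 i \is Num.real) -> (diag_mx w) ^t* = diag_mx w.
Proof.
move=> wR; rewrite adj_diag_mx; congr diag_mx; apply/rowP => i.
by rewrite mxE; apply/CrealP.
Qed.

Lemma herm_adj n (A : 'M[C]_n) : A \is hermsymmx -> A ^t* = A.
Proof. by move=> /is_hermitianmxP; rewrite expr0 scale1r => <-. Qed.

Lemma adj_herm n (A : 'M[C]_n) : A ^t* = A -> A \is hermsymmx.
Proof. by move=> Ah; apply/is_hermitianmxP; rewrite expr0 scale1r Ah. Qed.

Lemma unitary_adjK n (U : 'M[C]_n) : U \is unitarymx -> U ^t* *m U = 1%:M.
Proof. by move=> Uu; rewrite -invmx_unitary // mulVmx // unitarymx_unit. Qed.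

Lemma gram_ge0 m n (M : 'M[C]_(m, n)) i : 0 <= (M *m M ^t*) i i.
Proof.
by rewrite mxE sumr_ge0 // => j _; rewrite !mxE mul_conjC_ge0.
Qed.

Lemma trace_gram_ge0 m n (M : 'M[C]_(m, n)) : 0 <= \tr (M *m M ^t*).
Proof. by apply: sumr_ge0 => i _; apply: gram_ge0. Qed.

Lemma mulmx_quad m n p (V : 'M[C]_(m, n)) (A : 'M[C]_(n, p)) (W : 'M[C]_(m, p)) i :
  (V *m A *m W ^t*) i i = (row i V *m A *m (row i W) ^t*) 0 0.
Proof.
rewrite -row_mul !mxE; apply: eq_bigr => j _; congr (_ * _); last by rewrite !mxE.
by rewrite [in RHS]mxE.
Qed.

Lemma psd_congr m n (R : 'M[C]_(m, n)) (A : 'M[C]_n) :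
  psdmx A -> psdmx (R *m A *m R ^t*).
Proof.
case=> Ah A0; split; first by rewrite adj_herm // !adjmxM trmxCK herm_adj // mulmxA.
move=> v; have := A0 (v *m R).
by rewrite adjmxM !mulmxA.
Qed.

Lemma psd1 n : psdmx (1%:M : 'M[C]_n).
Proof.
split; first by rewrite adj_herm // adjmx1.
by move=> v; rewrite mulmx1 gram_ge0.
Qed.

Lemma psd0 n : psdmx (0 : 'M[C]_n).
Proof.
split; first by rewrite adj_herm // trmx0 map_mx0.
by move=> v; rewrite mulmx0 mul0mx mxE.
Qed.

Lemma psdD n (A B : 'M[C]_n) : psdmx A -> psdmx B -> psdmx (A + B).
Proof.
move=> [Ah A0] [Bh B0]; split.
  by rewrite adj_herm // linearD map_mxD !herm_adj.
by move=> v; rewrite mulmxDr mulmxDl mxE addr_ge0.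
Qed.

Lemma psd_sum (I : Type) (r : seq I) n (A : I -> 'M[C]_n) :
  (forall i, psdmx (A i)) -> psdmx (\sum_(i <- r) A i).
Proof.
by move=> Apsd; apply: big_ind => //; [exact: psd0 | exact: psdD].
Qed.

(* W is a partial isometry, hence a contraction: v v* - v W* W v* is the Gram
   value of v - v W* W. *)
Lemma partial_isometry_le m n (W : 'M[C]_(m, n)) p (V : 'M[C]_(p, n)) i :
  W *m W ^t* *m W = W ->
  (V *m W ^t* *m (V *m W ^t*) ^t*) i i <= (V *m V ^t*) i i.
Proof.
move=> WW; rewrite -subr_ge0.
have <- : ((V - V *m W ^t* *m W) *m (V - V *m W ^t* *m W) ^t*) i i =
   (V *m V ^t*) i i - (V *m W ^t* *m (V *m W ^t*) ^t*) i i.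
  have -> : forall A B : 'M[C]_p, A i i - B i i = (A - B) i i.
    by move=> A B; rewrite !mxE.
  congr (fun M : 'M[C]_p => M i i).
  rewrite linearB map_mxB !adjmxM trmxCK mulmxBl !mulmxBr !mulmxA.
  have -> : V *m W ^t* *m W *m W ^t* *m W = V *m W ^t* *m W.
    by rewrite -!(mulmxA (V *m W ^t*)) WW.
  by rewrite subrr subr0.
exact: gram_ge0.
Qed.

Lemma unitary_partial_isometry m n (V : 'M[C]_(m, n)) :
  V \is unitarymx -> V *m V ^t* *m V = V.
Proof. by move=> /unitarymxP ->; rewrite mul1mx. Qed.

Lemma unitary_leq m n (V : 'M[C]_(m, n)) : V \is unitarymx -> (m <= n)%N.
Proof. by move=> /mxrank_unitary <-; apply: rank_leq_col. Qed.

(** * Unitary diagonalization of Hermitian matrices *)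

(** A common unitary triangularization suffices: a triangular Hermitian matrix is diagonal with real
    entries. *)
Lemma herm_codiag n (A B : 'M[C]_n) :
  A ^t* = A -> B ^t* = B -> A *m B = B *m A ->
  exists U : 'M[C]_n, exists a : 'rV[C]_n, exists b : 'rV[C]_n,
  [/\ U \is unitarymx, A = U ^t* *m diag_mx a *m U, B = U ^t* *m diag_mx b *m U,
      forall i, a 0 i \is Num.real & forall i, b 0 i \is Num.real].
Proof.
move=> Ah Bh /cotrigonalization2[U Uu /andP[UA UB]].
have diagE M : M ^t* = M -> similar_trig U M ->
    exists2 w : 'rV[C]_n, M = U ^t* *m diag_mx w *m U &
      forall i, w 0 i \is Num.real.
  move=> Mh Ut.
  have [D DE] : {D : 'M[C]_n | D = U *m M *m U ^t*} by eexists.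
  have {}Ut : is_trig_mx D by rewrite DE -conjymx.
  have Dh i j : D j i = (D i j)^*.
    have /matrixP/(_ j i) : D ^t* = D by rewrite DE !adjmxM trmxCK Mh mulmxA.
    by rewrite [in LHS]mxE [in LHS]mxE => <-.
  exists (\row_i D i i); last by move=> i; rewrite mxE; apply/CrealP; rewrite -Dh.
  have <- : D = diag_mx (\row_i D i i).
    apply/matrixP => i j; rewrite !mxE.
    move/is_trig_mxP: Ut => Ut.
    case: (ltngtP i j) => [ij|ij|/val_inj ->]; last by rewrite eqxx.
      by rewrite Ut // -val_eqE ltn_eqF.
    by rewrite Dh Ut // conjC0 -val_eqE gtn_eqF.
  by rewrite DE !mulmxA unitary_adjK // mul1mx -mulmxA unitary_adjK // mulmx1.
have [a Aa aR] := diagE _ Ah UA; have [b Bb bR] := diagE _ Bh UB.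
by exists U, a, b; split.
Qed.

Lemma diag_conj_sqr n (U : 'M[C]_n) (x : 'rV[C]_n) : U \is unitarymx ->
  (U ^t* *m diag_mx x *m U) *m (U ^t* *m diag_mx x *m U) =
  U ^t* *m diag_mx (\row_i x 0 i ^+ 2) *m U.
Proof.
move=> Uu; rewrite -!mulmxA; congr (_ *m _).
rewrite !mulmxA -(mulmxA (diag_mx x)) (unitarymxP Uu) mulmx1 mulmx_diag.
by congr (diag_mx _ *m _); apply/rowP => i; rewrite !mxE expr2.
Qed.

Lemma psd_diag_ge0 n (U : 'M[C]_n) (a : 'rV[C]_n) :
  U \is unitarymx -> psdmx (U ^t* *m diag_mx a *m U) -> forall i, 0 <= a 0 i.
Proof.
move=> Uu [_ A0] i; have := A0 (row i U).
rewrite -mulmx_quad !mulmxA.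
rewrite (unitarymxP Uu) mul1mx -mulmxA (unitarymxP Uu) mulmx1.
by rewrite mxE eqxx.
Qed.

(** * Sorted eigenvalues and singular values *)

(** The order on [C] is partial; nonnegativity makes the entries comparable, so that sorting depends
    only on the multiset. *)
Lemma sort_dec_perm (s t : seq C) :
  all (fun x => 0 <= x) s -> perm_eq s t -> sort_dec s = sort_dec t.
Proof.
move=> s0 st; have sR x : x \in s -> x \is Num.real.
  by move=> xs; rewrite ger0_real // (allP s0).
apply/perm_sort_inP => //.
- by move=> x y xs ys; rewrite /= real_leVge ?sR.
- by move=> x y z _ _ _ /= yx zx; apply: le_trans zx yx.
- by move=> x y _ _ /= /andP[yx xy]; apply/le_anti; rewrite xy yx.
Qed.

Lemma sort_decK (s : seq C) :
  all (fun x => 0 <= x) s -> sort_dec (sort_dec s) = sort_dec s.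
Proof.
by move=> s0; apply/esym/sort_dec_perm => //; rewrite perm_sym perm_sort.
Qed.

(** [eigvals] is known only as a root list of the characteristic polynomial, hence up to
    permutation; unitary similarity preserves that polynomial. *)
Lemma eigvals_diag n (U : 'M[C]_n) (w : 'rV[C]_n) :
  U \is unitarymx ->
  perm_eq (eigvals (U ^t* *m diag_mx w *m U)) [seq w 0 i | i : 'I_n].
Proof.
move=> Uu; apply: prod_XsubC_eq; rewrite /eigvals.
case: (closed_field_poly_normal _) => s /= sE.
have : char_poly (U ^t* *m diag_mx w *m U) = char_poly (diag_mx w).
  rewrite /char_poly /char_poly_mx.
  have -> : 'X%:M - map_mx polyC (U ^t* *m diag_mx w *m U) =
     map_mx polyC (U ^t*) *m ('X%:M - map_mx polyC (diag_mx w)) *m map_mx polyC U.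
    rewrite mulmxBr mulmxBl -!map_mxM; congr (_ - _).
    by rewrite scalar_mxC -mulmxA -map_mxM unitary_adjK // map_mx1 mulmx1.
  rewrite !det_mulmx mulrC mulrA -det_mulmx -map_mxM (unitarymxP Uu) map_mx1 det1.
  by rewrite mul1r.
move: sE; rewrite (monicP (char_poly_monic _)) scale1r => <- ->.
rewrite char_poly_trig ?diag_mx_is_trig // big_map big_enum /=.
by apply: eq_bigr => i _; rewrite mxE eqxx.
Qed.

(** Lets any unitary diagonalization compute the singular values. The extra sort is the one made by
    [weak_maj]. *)
Lemma sort_dec_singvals n (X U : 'M[C]_n) (w : 'rV[C]_n) :
  U \is unitarymx -> (forall i, 0 <= w 0 i) ->
  X ^t* *m X = U ^t* *m diag_mx w *m U ->
  sort_dec (singvals X) = sort_dec [seq sqrtC (w 0 i) | i : 'I_n].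
Proof.
move=> Uu w0 XX.
have P : perm_eq [seq sqrtC z | z <- eigvals (X ^t* *m X)]
           [seq sqrtC (w 0 i) | i : 'I_n].
  have -> : [seq sqrtC (w 0 i) | i : 'I_n] =
      [seq sqrtC z | z <- [seq w 0 i | i : 'I_n]] by rewrite /image_mem -map_comp.
  apply: perm_map.
  by rewrite XX eigvals_diag.
have s0 : all (fun x => 0 <= x) [seq sqrtC (w 0 i) | i : 'I_n].
  by apply/allP => _ /mapP[i _ ->]; rewrite sqrtC_ge0.
rewrite /singvals sort_decK; last by rewrite (perm_all _ P).
by apply: sort_dec_perm => //; rewrite (perm_all _ P).
Qed.

Lemma size_singvals n (X : 'M[C]_n) : size (singvals X) = n.
Proof.
rewrite /singvals /sort_dec size_sort size_map /eigvals.
case: (closed_field_poly_normal _) => s /= /(congr1 (fun p : {poly C} => size p)).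
rewrite (monicP (char_poly_monic _)) scale1r size_char_poly.
by rewrite size_prod_XsubC => -[].
Qed.

(** A fractional knapsack bound: weights in [0,1] of total at most [k] do best on the indicator of
    the [k] largest values. It serves as the variational principle for top-[k] sums. *)
Lemma sort_dec_top n k (w : 'I_n -> C) :
  (forall i, 0 <= w i) -> (k <= n)%N ->
  exists J : {set 'I_n}, [/\ #|J| = k,
    \sum_(j < k) (sort_dec [seq w i | i : 'I_n])`_j = \sum_(i in J) w i &
    forall p : 'I_n -> C, (forall i, 0 <= p i <= 1) -> \sum_i p i <= k%:R ->
      \sum_i w i * p i <= \sum_(i in J) w i].
Proof.
move=> w0 kn.
pose leT : rel 'I_n := fun x y => w y <= w x.
pose s := sort leT (enum 'I_n).
have leT_tot : total leT by move=> x y; rewrite /leT real_leVge ?ger0_real.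
have leT_tr : transitive leT by move=> x y z xy yz; apply: le_trans yz xy.
have s_sorted : sorted leT s by apply: sort_sorted.
have s_perm : perm_eq s (enum 'I_n) by rewrite perm_sort.
have s_size : size s = n by rewrite (perm_size s_perm) size_enum_ord.
have s_uniq : uniq s by rewrite (perm_uniq s_perm) enum_uniq.
have s_mem i : i \in s by rewrite (perm_mem s_perm) mem_enum.
have t_uniq : uniq (take k s) by rewrite take_uniq.
have t_size : size (take k s) = k by rewrite size_takel ?s_size.
(* The threshold [c] is the largest value left out, or the default 0 when [k = n]. Being
   nonnegative, it tolerates weights of total below [k]. *)
pose c := (map w s)`_k.
have c0 : 0 <= c.
  rewrite /c; case: (ltnP k n) => [lt_kn|le_nk].
    by rewrite (nth_map (Ordinal lt_kn)) ?s_size.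
  by rewrite nth_default // size_map s_size.
have c_in i : i \in take k s -> c <= w i.
  move=> it; rewrite /c; case: (ltnP k n) => [lt_kn|le_nk]; last first.
    by rewrite nth_default // size_map s_size.
  rewrite (nth_map i) ?s_size //.
  apply: (sorted_leq_index leT_tr _ s_sorted) => //; first by move=> x; exact: lexx.
  by rewrite index_uniq ?s_size // ltnW // -in_take.
have c_out i : i \notin take k s -> w i <= c.
  move=> it; have lt_in : (k <= index i s)%N.
    by rewrite leqNgt -in_take.
  have lt_kn : (k < n)%N.
    by rewrite (leq_ltn_trans lt_in) // -[leqRHS]s_size index_mem.
  rewrite /c (nth_map i) ?s_size //.
  apply: (sorted_leq_index leT_tr _ s_sorted) => //; first by move=> x; exact: lexx.
  by rewrite index_uniq ?s_size.
exists [set i in take k s]; split.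
- by rewrite cardsE (card_uniqP t_uniq).
- rewrite /sort_dec sort_map -/leT -[sort _ _]/s.
  transitivity (\sum_(i <- take k s) w i).
    rewrite -(big_map w xpredT id) (big_nth 0) size_map t_size big_mkord.
    by apply: eq_bigr => i _; rewrite map_take nth_take.
  rewrite big_uniq //; apply: eq_bigl => i; by rewrite inE.
- move=> p p01 pk.
  have -> : \sum_(i in [set i in take k s]) w i =
      \sum_i (if i \in take k s then w i else 0).
    by rewrite -big_mkcond /=; apply: eq_bigl => i; rewrite inE.
  have kE : k%:R = \sum_(i < n) (if i \in take k s then 1 else 0) :> C.
    by rewrite -big_mkcond /= sumr_const (card_uniqP t_uniq) t_size.
  (* Weight is priced at [c] per unit: chosen values are at least [c], the others at most [c], and
     the price terms add up to a nonpositive amount. *)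
  apply: (@le_trans _ _ (\sum_i ((if i \in take k s then w i else 0) +
      c * (p i - if i \in take k s then 1 else 0)))); last first.
    rewrite big_split /= -mulr_sumr sumrB -kE gerDl.
    by rewrite mulr_ge0_le0 // subr_le0.
  apply: ler_sum => i _; have /andP[p0 p1] := p01 i.
  case: ifPn => it.
    rewrite -subr_ge0.
    have -> : w i + c * (p i - 1) - w i * p i = (w i - c) * (1 - p i) by ring.
    by rewrite mulr_ge0 ?subr_ge0 ?c_in.
  by rewrite add0r subr0 ler_wpM2r ?c_out.
Qed.

(** * Traces of compressions and Ky Fan's inequality *)

Lemma trace_adj n (M : 'M[C]_n) : \tr (M ^t*) = (\tr M)^*.
Proof. by rewrite trace_map_mx mxtrace_tr. Qed.

Lemma trace_diag_mul n (w : 'rV[C]_n) (M : 'M[C]_n) :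
  \tr (diag_mx w *m M) = \sum_i w 0 i * M i i.
Proof. by apply: eq_bigr => i _; rewrite mul_diag_mx mxE. Qed.

(* The weights p are the squared column norms of V U^*. *)
Lemma trace_diag_weights m n (V : 'M[C]_(m, n)) (U : 'M[C]_n) :
  V \is unitarymx -> U \is unitarymx ->
  exists p : 'I_n -> C, [/\ forall i, 0 <= p i <= 1, \sum_i p i = m%:R &
    forall w : 'rV[C]_n,
      \tr (V *m (U ^t* *m diag_mx w *m U) *m V ^t*) = \sum_i w 0 i * p i].
Proof.
move=> Vu Uu; pose Q := U *m V ^t*.
have Qh : Q ^t* = V *m U ^t* by rewrite adjmxM trmxCK.
exists (fun i => (Q *m Q ^t*) i i); split.
- move=> i; rewrite gram_ge0 /=.
  apply: le_trans (partial_isometry_le _ _ (unitary_partial_isometry Vu)) _.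
  by rewrite (unitarymxP Uu) mxE eqxx.
- transitivity (\tr (Q *m Q ^t*)); first by [].
  rewrite mxtrace_mulC Qh /Q mulmxA -(mulmxA V) unitary_adjK // mulmx1.
  by rewrite (unitarymxP Vu) mxtrace1.
- move=> w; rewrite -trace_diag_mul Qh /Q.
  by rewrite -!mulmxA mulmxA [in LHS]mxtrace_mulC !mulmxA.
Qed.

(* Ky Fan's inequality, from the polar-type factorization
   M^* = U^* diag(sigma) W with W a partial isometry. *)
Lemma norm_trace_singvals m d k (E : 'M[C]_(m, d)) (M : 'M[C]_d) :
  E \is unitarymx -> (m <= k <= d)%N ->
  `|\tr (E *m M *m E ^t*)| <= \sum_(j < k) (sort_dec (singvals M))`_j.
Proof.
move=> Eu /andP[mk kd].
have MMpsd : psdmx (M ^t* *m M).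
  by have := psd_congr (M ^t*) (psd1 d); rewrite mulmx1 trmxCK.
have [U [w [_ [Uu MME _ _ _]]]] :=
  herm_codiag (herm_adj MMpsd.1) (herm_adj MMpsd.1) (erefl _).
have w0 : forall i, 0 <= w 0 i by apply: (psd_diag_ge0 Uu); rewrite -MME.
rewrite (sort_dec_singvals Uu w0 MME).
have s0 i : 0 <= sqrtC (w 0 i) by rewrite sqrtC_ge0.
have [J [_ -> Jmax]] := sort_dec_top s0 kd.
pose s := \row_i sqrtC (w 0 i).
have [N NE] : {N | N = U *m M ^t*} by eexists.
have NN : N *m N ^t* = diag_mx w.
  rewrite NE adjmxM trmxCK -!mulmxA (mulmxA (M ^t*)) MME.
  by rewrite !mulmxA (unitarymxP Uu) mul1mx -mulmxA (unitarymxP Uu) mulmx1.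
(* Since the inverse of 0 is 0, [W] has zero rows where the singular value vanishes. *)
have [W WE] : {W | W = diag_mx (map_mx GRing.inv s) *m N} by eexists.
have NW : N = diag_mx s *m W.
  apply/matrixP => i j; rewrite WE mulmxA mulmx_diag mul_diag_mx !mxE.
  have [wi0|wi0] := eqVneq (sqrtC (w 0 i)) 0; last by rewrite divff // mul1r.
  rewrite wi0 !mul0r.
  (* The squared norm of row [i] of [N] is [w 0 i], so the row vanishes with the singular value. *)
  have /eqP : (N *m N ^t*) i i = 0.
    by rewrite NN mxE eqxx /=; apply/eqP; rewrite -sqrtC_eq0 wi0.
  rewrite mxE psumr_eq0; last by move=> l _; rewrite !mxE mul_conjC_ge0.
  move=> /allP/(_ j); rewrite mem_index_enum => /(_ isT) /=.
  by rewrite !mxE mul_conjC_eq0 => /eqP.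
have WW : W *m W ^t* = diag_mx (\row_i (w 0 i != 0)%:R).
  rewrite WE adjmxM real_diag_mx_adj; last first.
    by move=> i; rewrite !mxE rpredV ger0_real.
  rewrite !mulmxA -(mulmxA _ N) NN !mulmx_diag; congr diag_mx; apply/rowP => i.
  rewrite !mxE; have [->|wi0] := eqVneq (w 0 i) 0.
    by rewrite mulr0 mul0r.
  by rewrite mulrAC -invfM -expr2 sqrtCK mulVf.
have WWW : W *m W ^t* *m W = W.
  rewrite WW; apply/matrixP => i j; rewrite mul_diag_mx !mxE.
  have [wi0|wi0] := eqVneq (w 0 i) 0; last by rewrite mul1r.
  by rewrite mul0r WE mul_diag_mx !mxE wi0 sqrtC0 invr0 mul0r.
have ME : M ^t* = U ^t* *m diag_mx s *m W.
  by rewrite -mulmxA -NW NE mulmxA unitary_adjK // mul1mx.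
have [P PE] : {P | P = U *m E ^t*} by eexists.
have [Q QE] : {Q | Q = W *m E ^t*} by eexists.
have trE : \tr (E *m M ^t* *m E ^t*) = \sum_i s 0 i * (Q *m P ^t*) i i.
  rewrite -trace_diag_mul ME PE adjmxM trmxCK QE.
  by rewrite -!mulmxA mulmxA [in LHS]mxtrace_mulC !mulmxA.
have -> : \tr (E *m M *m E ^t*) = (\tr (E *m M ^t* *m E ^t*))^*.
  by rewrite -trace_adj !adjmxM !trmxCK mulmxA.
rewrite norm_conjC.
have EEE := unitary_partial_isometry Eu.
have P1 i : (P *m P ^t*) i i <= 1.
  rewrite PE.
  apply: le_trans (partial_isometry_le _ _ EEE) _.
  by rewrite (unitarymxP Uu) mxE eqxx.
have Q1 i : (Q *m Q ^t*) i i <= 1.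
  rewrite QE.
  apply: le_trans (partial_isometry_le _ _ EEE) _.
  by rewrite WW !mxE eqxx mulr1n lern1 leq_b1.
have sumP : \sum_i (P *m P ^t*) i i <= m%:R.
  rewrite -[leLHS]/(\tr (P *m P ^t*)) mxtrace_mulC PE adjmxM trmxCK.
  by rewrite mulmxA -(mulmxA E) unitary_adjK // mulmx1 (unitarymxP Eu) mxtrace1.
have sumQ : \sum_i (Q *m Q ^t*) i i <= m%:R.
  rewrite -[leLHS]/(\tr (Q *m Q ^t*)) mxtrace_mulC QE adjmxM trmxCK.
  rewrite mulmxA -(mulmxA E).
  have -> : m%:R = \tr (E *m E ^t*) by rewrite (unitarymxP Eu) mxtrace1.
  apply: ler_sum => i _.
  by have := partial_isometry_le E i WWW; rewrite adjmxM trmxCK !mulmxA.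
(* These weights come from [2 |x y| <= |x|^2 + |y|^2] applied to the entries of [P] and [Q]. *)
pose p i := ((P *m P ^t*) i i + (Q *m Q ^t*) i i) / 2.
have two0 : 2 != 0 :> C by rewrite pnatr_eq0.
apply: le_trans (Jmax p _ _); last 1 first.
- rewrite /p -mulr_suml big_split /= ler_pdivrMr ?ltr0n // mulrDr mulr1.
  rewrite (le_trans (lerD sumP sumQ)) //.
  by rewrite lerD ?ler_nat.
- rewrite trE; apply: le_trans (ler_norm_sum _ _ _) _.
  apply: ler_sum => i _; rewrite normrM mxE (ger0_norm (s0 i)) ler_wpM2l //.
  rewrite mxE; apply: le_trans (ler_norm_sum _ _ _) _.
  rewrite /p !mxE -big_split /= mulr_suml; apply: ler_sum => l _.
  rewrite !mxE normrM norm_conjC -!normCK ler_pdivlMr ?ltr0n //.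
  rewrite -subr_ge0.
  set x := `|_| ; set y := `|_|.
  have -> : x ^+ 2 + y ^+ 2 - y * x * 2 = (y - x) ^+ 2 by ring.
  by rewrite -realEsqr rpredB // normr_real.
- move=> i; rewrite /p divr_ge0 ?addr_ge0 ?gram_ge0 //=.
  by rewrite ler_pdivrMr ?ltr0n // mul1r lerD.
Qed.

(** * Invariant subspaces and eigenvalues shared by [X Z] and [Z X] *)

Lemma spectral_rows n (U : 'M[C]_n) (w : 'rV[C]_n) (J : {set 'I_n}) :
  U \is unitarymx ->
  exists V : 'M[C]_(#|J|, n), exists l : 'rV[C]_#|J|,
  [/\ V \is unitarymx, V *m (U ^t* *m diag_mx w *m U) = diag_mx l *m V,
      forall F : C -> C, \sum_i F (l 0 i) = \sum_(i in J) F (w 0 i) &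
      forall i, exists2 j, j \in J & l 0 i = w 0 j].
Proof.
move=> Uu; pose f (i : 'I_#|J|) : 'I_n := enum_val i.
exists (rowsub f U), (\row_i w 0 (f i)); split.
- apply/unitarymxP/matrixP => i j.
  have /matrixP/(_ (f i) (f j)) := unitarymxP Uu; rewrite [RHS]mxE => UU.
  rewrite [RHS]mxE -(inj_eq enum_val_inj) -[RHS]UU !mxE.
  by apply: eq_bigr => l _; rewrite !mxE.
- rewrite mul_rowsub_mx !mulmxA (unitarymxP Uu) mul1mx.
  by apply/matrixP => i j; rewrite mxE !mul_diag_mx !mxE.
- by move=> F; rewrite [RHS]big_enum_val; apply: eq_bigr => i _; rewrite mxE.
- by move=> i; exists (f i); [exact: enum_valP | rewrite mxE].
Qed.

(** Gram-Schmidt replaces [Y] by an orthonormal basis of its row space. The change of basis makes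
    [Th] similar to [L], which preserves both traces. *)
Lemma orthonormal_compression m n (Y : 'M[C]_(m, n)) (L : 'M[C]_m) (N : 'M[C]_n) :
  row_free Y -> Y *m N = L *m Y ->
  exists E : 'M[C]_(m, n), exists Th : 'M[C]_m,
  [/\ E \is unitarymx, E *m N = Th *m E, \tr Th = \tr L &
      \tr (Th *m Th) = \tr (L *m L)].
Proof.
move=> Yfree YN.
have mn : (m <= n)%N by rewrite -(eqP Yfree) rank_leq_col.
have EY := eqmx_schmidt_free Yfree.
have /submxP[G EG] : (schmidt Y <= Y)%MS by rewrite EY.
have /submxP[G' YG] : (Y <= schmidt Y)%MS by rewrite EY.
have GG : G' *m G = 1%:M.
  by apply: (row_free_inj Yfree); rewrite mul1mx -mulmxA -EG -YG.
exists (schmidt Y), (G *m L *m G'); split.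
- exact: schmidt_unitarymx.
- by rewrite [in LHS]EG -[LHS]mulmxA YN -!mulmxA -YG.
- by rewrite mxtrace_mulC mulmxA GG mul1mx.
- have -> : G *m L *m G' *m (G *m L *m G') = G *m (L *m L *m G').
    by rewrite -!mulmxA (mulmxA G') GG mul1mx.
  by rewrite mxtrace_mulC -!mulmxA GG mulmx1.
Qed.

(* X Z and Z X share their nonzero eigenvalues: V X, for V the chosen
   eigenvectors of X Z, spans a subspace invariant under Z X. *)
Lemma swap_compression d n (X : 'M[C]_(d, n)) (Z : 'M[C]_(n, d)) (U : 'M[C]_d)
    (w : 'rV[C]_d) (J : {set 'I_d}) :
  U \is unitarymx -> X *m Z = U ^t* *m diag_mx w *m U ->
  exists m : nat, exists E : 'M[C]_(m, n), exists Th : 'M[C]_m,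
  [/\ (m <= #|J|)%N, E \is unitarymx, E *m (Z *m X) = Th *m E,
      \tr Th = \sum_(i in J) w 0 i & \tr (Th *m Th) = \sum_(i in J) w 0 i ^+ 2].
Proof.
(* Zero eigenvalues are discarded so that the rows of [V X] are independent; they contribute nothing
   to either sum. *)
move=> Uu XZ; pose J' := [set i in J | w 0 i != 0].
have sumJ (F : C -> C) :
    F 0 = 0 -> \sum_(i in J') F (w 0 i) = \sum_(i in J) F (w 0 i).
  move=> F0; rewrite [RHS](bigID (fun i => w 0 i != 0)) /= [X in _ + X]big1.
    by rewrite addr0; apply: eq_bigl => i; rewrite inE.
  by move=> i /andP[_]; rewrite negbK => /eqP ->.
have [V [l [Vu VH lF lJ]]] := spectral_rows w J' Uu.
have l0 i : l 0 i != 0 by have [j] := lJ i; rewrite inE => /andP[_ wj] ->.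
have VXZ : V *m X *m Z = diag_mx l *m V by rewrite -mulmxA XZ.
have Yfree : row_free (V *m X).
  apply/row_freeP; exists (Z *m V ^t* *m diag_mx (map_mx GRing.inv l)).
  rewrite !mulmxA VXZ -(mulmxA _ V) (unitarymxP Vu) mulmx1 mulmx_diag.
  by apply/matrixP => i j; rewrite !mxE mulfV.
have YN : (V *m X) *m (Z *m X) = diag_mx l *m (V *m X).
  by rewrite (mulmxA (V *m X)) VXZ !mulmxA.
have [E [Th [Eu EN trTh trTh2]]] := orthonormal_compression Yfree YN.
exists #|J'|, E, Th; split => //.
- by apply/subset_leq_card/subsetP => i; rewrite inE => /andP[].
- by rewrite trTh mxtrace_diag (lF id) (sumJ id).
- rewrite trTh2 mulmx_diag mxtrace_diag.
  under eq_bigr do rewrite mxE -expr2.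
  by rewrite (lF (fun x => x ^+ 2)) (sumJ (fun x => x ^+ 2)) // expr0n.
Qed.

(** * Trace bounds by singular values of a product *)

Lemma compressionE m n (E : 'M[C]_(m, n)) (N : 'M[C]_n) (Th : 'M[C]_m) :
  E \is unitarymx -> E *m N = Th *m E -> Th = E *m N *m E ^t*.
Proof. by move=> Eu ->; rewrite -mulmxA (unitarymxP Eu) mulmx1. Qed.

(* Weyl-type bound: the nonzero eigenvalues of T^* A T are eigenvalues of
   A T T^*, whose compression E has trace controlled by Ky Fan. *)
Lemma trace_congr_le_singvals d n (T : 'M[C]_(d, n)) (A : 'M[C]_d) m k
    (V : 'M[C]_(m, n)) :
  psdmx A -> V \is unitarymx -> (m <= k <= d)%N ->
  \tr (V *m (T ^t* *m A *m T) *m V ^t*) <=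
    \sum_(j < k) (sort_dec (singvals (A *m T *m T ^t*)))`_j.
Proof.
move=> Apsd Vu /andP[mk kd].
have Hpsd : psdmx (T ^t* *m A *m T).
  by have := psd_congr (T ^t*) Apsd; rewrite trmxCK.
have [U [w [_ [Uu HE _ _ _]]]] :=
  herm_codiag (herm_adj Hpsd.1) (herm_adj Hpsd.1) (erefl _).
have w0 : forall i, 0 <= w 0 i by apply: (psd_diag_ge0 Uu); rewrite -HE.
have [J [Jm _ Jmax]] := sort_dec_top w0 (unitary_leq Vu).
have [p [p01 pm pE]] := trace_diag_weights Vu Uu.
rewrite HE pE; apply: le_trans (Jmax p p01 _) _; first by rewrite pm.
have XZ : T ^t* *m (A *m T) = U ^t* *m diag_mx w *m U by rewrite mulmxA.
have [m' [E [Th [m'J Eu EN trTh _]]]] := swap_compression J Uu XZ.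
have J0 : 0 <= \sum_(i in J) w 0 i by apply: sumr_ge0.
(* The trace is a sum of nonnegative eigenvalues, hence equals its modulus, which Ky Fan bounds. *)
rewrite -trTh -[leLHS]ger0_norm ?trTh // -trTh (compressionE Eu EN).
apply: norm_trace_singvals => //.
by rewrite kd andbT (leq_trans m'J) // Jm.
Qed.

(* Schur's inequality |tr M^2| <= tr (M M^* ), from tr ((M - M^* )(M - M^* )^* ) >= 0. *)
Lemma trace_sqr_le m (M : 'M[C]_m) :
  \tr (M *m M) \is Num.real -> \tr (M *m M) <= \tr (M *m M ^t*).
Proof.
move=> MR; have := trace_gram_ge0 (M - M ^t*).
rewrite linearB map_mxB trmxCK mulmxBl !mulmxBr !linearB /=.
rewrite -adjmxM trace_adj (CrealP MR) (mxtrace_mulC (M ^t*)).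
set x := \tr _; set y := \tr _ => xy.
rewrite -subr_ge0 -(pmulrn_lge0 _ (n := 2)) //.
by congr (0 <= _) : xy; ring.
Qed.

Lemma trace_sqr_le_singvals d n (R T : 'M[C]_(d, n)) m k (V : 'M[C]_(m, d)) :
  (R *m T ^t*) \is hermsymmx -> V \is unitarymx -> (m <= k <= d)%N ->
  \tr (V *m (R *m T ^t* *m (R *m T ^t*)) *m V ^t*) <=
    \sum_(j < k) (sort_dec (singvals (R *m R ^t* *m (T *m T ^t*))))`_j.
Proof.
move=> /herm_adj Xh Vu /andP[mk kd].
have [U [x [_ [Uu XE _ xR _]]]] := herm_codiag Xh Xh (erefl _).
pose w := \row_i x 0 i ^+ 2.
have XX : R *m T ^t* *m (R *m T ^t*) = U ^t* *m diag_mx w *m U.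
  by rewrite XE diag_conj_sqr.
have w0 i : 0 <= w 0 i by rewrite mxE -realEsqr.
have [J [Jm _ Jmax]] := sort_dec_top w0 (unitary_leq Vu).
have [p [p01 pm pE]] := trace_diag_weights Vu Uu.
rewrite XX pE; apply: le_trans (Jmax p p01 _) _; first by rewrite pm.
(* The swap is applied to [R T^*] rather than to its square: [Th] then compresses [T^* R], and the
   trace of [Th^2] supplies the squared eigenvalues. *)
have [m' [E [Th [m'J Eu EN _ trTh]]]] := swap_compression J Uu XE.
have trE : \tr (Th *m Th) = \sum_(i in J) w 0 i.
  by rewrite trTh; apply: eq_bigr => i _; rewrite mxE.
rewrite -trE; apply: le_trans (trace_sqr_le _) _.
  by rewrite trE rpred_sum // => i _; rewrite ger0_real.
have -> : Th *m Th ^t* = E *m (T ^t* *m (R *m R ^t*) *m T) *m E ^t*.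
  have -> : Th *m Th ^t* = (Th *m E) *m (Th *m E) ^t*.
    by rewrite adjmxM mulmxA -(mulmxA Th) (unitarymxP Eu) mulmx1.
  by rewrite -EN !adjmxM trmxCK !mulmxA.
rewrite (mulmxA (R *m R ^t*) T); apply: trace_congr_le_singvals => //.
  by have := psd_congr R (psd1 n); rewrite mulmx1.
by rewrite kd andbT (leq_trans m'J) // Jm.
Qed.

(** * Sums of squares of positive semidefinite matrices *)

(** The rows of [W] are eigenvectors of [H] for the largest eigenvalues of [H^2]; on each, the
    quadratic form of [G] bounds the modulus of the eigenvalue of [H]. *)
Lemma trace_sqr_dominated n (H G : 'M[C]_n) m (V : 'M[C]_(m, n)) :
  H \is hermsymmx -> G \is hermsymmx ->
  (forall v : 'rV[C]_n, 0 <= (v *m (G - H) *m v ^t*) 0 0) ->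
  (forall v : 'rV[C]_n, 0 <= (v *m (G + H) *m v ^t*) 0 0) ->
  V \is unitarymx ->
  exists2 W : 'M[C]_(m, n), W \is unitarymx &
    \tr (V *m (H *m H) *m V ^t*) <= \tr (W *m (G *m G) *m W ^t*).
Proof.
move=> /herm_adj Hh /herm_adj Gh GmH GpH Vu.
have [U [x [_ [Uu HE _ xR _]]]] := herm_codiag Hh Hh (erefl _).
pose w := \row_i x 0 i ^+ 2.
have HH : H *m H = U ^t* *m diag_mx w *m U.
  by rewrite HE diag_conj_sqr.
have w0 i : 0 <= w 0 i by rewrite mxE -realEsqr.
have [J [Jm _ Jmax]] := sort_dec_top w0 (unitary_leq Vu).
have [p [p01 pm pE]] := trace_diag_weights Vu Uu.
have [W [l [Wu WH lF lJ]]] := spectral_rows x J Uu.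
have le_tr : \tr (V *m (H *m H) *m V ^t*) <= \tr (W *m (G *m G) *m W ^t*).
  rewrite HH pE; apply: le_trans (Jmax p p01 _) _; first by rewrite pm.
  under eq_bigr do rewrite mxE; rewrite -(lF (fun x => x ^+ 2)).
  apply: ler_sum => i _.
  have WHi : (W *m H *m W ^t*) i i = l 0 i.
    by rewrite HE WH -mulmxA (unitarymxP Wu) mulmx1 mxE eqxx.
  have lR : l 0 i \is Num.real by have [j _ ->] := lJ i.
  pose g := (W *m G *m W ^t*) i i.
  have g_m : 0 <= g - l 0 i.
    have := GmH (row i W); rewrite -mulmx_quad mulmxBr mulmxBl.
    by rewrite -WHi [X in 0 <= X]mxE [X in _ + X]mxE.
  have g_p : 0 <= g + l 0 i.
    have := GpH (row i W); rewrite -mulmx_quad mulmxDr mulmxDl.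
    by rewrite -WHi [X in 0 <= X]mxE.
  apply: (@le_trans _ _ (g ^+ 2)).
    by rewrite -subr_ge0 subr_sqr mulr_ge0.
  (* Projecting row [i] of [W G] on the rows of [W] does not lengthen it, and [g] is one coordinate
     of the projection. *)
  have := partial_isometry_le (W *m G) i (unitary_partial_isometry Wu).
  rewrite [X in _ <= X -> _](_ : _ = (W *m (G *m G) *m W ^t*) i i); last first.
    by rewrite adjmxM Gh !mulmxA.
  apply: le_trans; rewrite mxE (bigD1 i) //= -/g.
  have gR : g \is Num.real.
    rewrite -[g](subrK (l 0 i)) rpredD // ger0_real //.
  rewrite adjmxE -/g (CrealP gR) -expr2 lerDl.
  by apply: sumr_ge0 => j _; rewrite adjmxE mul_conjC_ge0.
by clear Jmax; move: W l Wu WH lF lJ le_tr; rewrite Jm => W l Wu _ _ _ ?; exists W.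
Qed.

(* Induction on r via the parallelogram identity
   (H + X)^2 + (H - X)^2 = 2 (H^2 + X^2). *)
Lemma trace_sum_sqr_le n (I : Type) (r : seq I) (X : I -> 'M[C]_n) m c
    (H G : 'M[C]_n) :
  (forall i, psdmx (X i)) -> H \is hermsymmx -> G \is hermsymmx ->
  (forall v : 'rV[C]_n, 0 <= (v *m (G - H) *m v ^t*) 0 0) ->
  (forall v : 'rV[C]_n, 0 <= (v *m (G + H) *m v ^t*) 0 0) ->
  (forall W : 'M[C]_(m, n), W \is unitarymx ->
     let S := G + \sum_(i <- r) X i in \tr (W *m (S *m S) *m W ^t*) <= c) ->
  forall V : 'M[C]_(m, n), V \is unitarymx ->
    \tr (V *m (H *m H + \sum_(i <- r) X i *m X i) *m V ^t*) <= c.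
Proof.
(* Each step moves one matrix into [H] with either sign and into [G] with a plus, so [G] plus the
   remaining sum, and with it the bound [c], stays the same. *)
move=> Xpsd; elim: r H G => [|a r IHr] H G Hh Gh GmH GpH Sc V Vu.
  have [W Wu] := trace_sqr_dominated Hh Gh GmH GpH Vu.
  rewrite big_nil addr0 => /le_trans; apply.
  by have := Sc W Wu; rewrite /= big_nil addr0.
have [Xh X0] := Xpsd a.
have herm_pm (A B : 'M[C]_n) : A \is hermsymmx -> B \is hermsymmx ->
    (A + B \is hermsymmx) /\ (A - B \is hermsymmx).
  move=> /herm_adj Ah /herm_adj Bh; split; apply: adj_herm.
    by rewrite linearD map_mxD Ah Bh.
  by rewrite linearB map_mxB Ah Bh.
have quadD (A B : 'M[C]_n) :
    (forall v : 'rV[C]_n, 0 <= (v *m A *m v ^t*) 0 0) ->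
    (forall v : 'rV[C]_n, 0 <= (v *m B *m v ^t*) 0 0) ->
    forall v : 'rV[C]_n, 0 <= (v *m (A + B) *m v ^t*) 0 0.
  by move=> A0 B0 v; rewrite mulmxDr mulmxDl mxE addr_ge0.
have S'c (W : 'M[C]_(m, n)) : W \is unitarymx ->
    let S := G + X a + \sum_(i <- r) X i in \tr (W *m (S *m S) *m W ^t*) <= c.
  by move=> Wu; have := Sc W Wu; rewrite big_cons addrA.
(* When [H] becomes [H + X a] or [H - X a] and [G] becomes [G + X a], one of [G - H], [G + H] is
   unchanged and the other gains [2 X a]. *)
have XX0 := quadD _ _ X0 X0.
have plus : \tr (V *m ((H + X a) *m (H + X a) + \sum_(i <- r) X i *m X i) *m V ^t*)
    <= c.
  apply: (IHr _ (G + X a)) => //; try by apply: (herm_pm _ _ _ _).1.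
    by move=> v; rewrite opprD addrACA subrr addr0.
  by move=> v; rewrite addrACA; apply: quadD.
have minus : \tr (V *m ((H - X a) *m (H - X a) + \sum_(i <- r) X i *m X i) *m V ^t*)
    <= c.
  apply: (IHr _ (G + X a)) => //; try by [apply: (herm_pm _ _ _ _).1 | apply: (herm_pm _ _ _ _).2].
    by move=> v; rewrite opprB (addrC (X a)) addrACA; apply: quadD.
  by move=> v; rewrite addrACA subrr addr0.
have key : (H + X a) *m (H + X a) + \sum_(i <- r) X i *m X i +
     ((H - X a) *m (H - X a) + \sum_(i <- r) X i *m X i) =
     H *m H + \sum_(i <- a :: r) X i *m X i + (H *m H + \sum_(i <- a :: r) X i *m X i).
  rewrite big_cons !(mulmxDl, mulmxDr, mulNmx, mulmxN) opprK.
  move: (H *m H) (H *m X a) (X a *m H) (X a *m X a) (\sum_(i <- r) _).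
  by move=> HH HX XH XX S; apply/matrixP => i j; rewrite !mxE; ring.
rewrite -(ler_pMn2r (n := 2)) // [leRHS]mulr2n; apply: le_trans (lerD plus minus).
have trD (P Q : 'M[C]_n) :
    \tr (V *m P *m V ^t*) + \tr (V *m Q *m V ^t*) = \tr (V *m (P + Q) *m V ^t*).
  by rewrite mulmxDr mulmxDl linearD.
by rewrite trD key mulr2n trD.
Qed.

(** * Factorization of commuting pairs and conclusion *)

(** In a common eigenbasis the factors are [U^* sqrt(a)] and [U^* sqrt(b)], so their mixed product
    is [U^* sqrt(a) sqrt(b) U]. *)
Lemma psd_commuting_factors n (A B : 'M[C]_n) :
  psdmx A -> psdmx B -> A *m B = B *m A ->
  exists RT : 'M[C]_n * 'M[C]_n,
  [/\ RT.1 *m RT.1 ^t* = A, RT.2 *m RT.2 ^t* = B, psdmx (RT.1 *m RT.2 ^t*) &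
      RT.1 *m RT.2 ^t* *m (RT.1 *m RT.2 ^t*) = A *m B].
Proof.
move=> Apsd Bpsd AB.
have [U [a [b [Uu AE BE _ _]]]] := herm_codiag (herm_adj Apsd.1) (herm_adj Bpsd.1) AB.
have a0 : forall i, 0 <= a 0 i by apply: (psd_diag_ge0 Uu); rewrite -AE.
have b0 : forall i, 0 <= b 0 i by apply: (psd_diag_ge0 Uu); rewrite -BE.
pose s (w : 'rV[C]_n) : 'rV[C]_n := map_mx sqrtC w.
have s_adj (w : 'rV[C]_n) : (forall i, 0 <= w 0 i) -> (diag_mx (s w)) ^t* = diag_mx (s w).
  by move=> w0; apply: real_diag_mx_adj => i; rewrite mxE ger0_real // sqrtC_ge0.
have mulU (x y : 'rV[C]_n) :
    U ^t* *m diag_mx x *m (U ^t* *m diag_mx y) ^t* =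
    U ^t* *m (diag_mx x *m (diag_mx y) ^t*) *m U.
  by rewrite adjmxM trmxCK !mulmxA.
have ss (w : 'rV[C]_n) : diag_mx (s w) *m diag_mx (s w) = diag_mx w.
  by rewrite mulmx_diag; congr diag_mx; apply/rowP => i; rewrite !mxE -expr2 sqrtCK.
exists (U ^t* *m diag_mx (s a), U ^t* *m diag_mx (s b)) => /=.
rewrite !mulU !s_adj // !ss; split => //.
(* A further square root [q] exhibits the mixed product as a Gram matrix, hence positive
   semidefinite. *)
- pose q := s (\row_i (s a 0 i * s b 0 i)).
  have q_adj : (diag_mx q) ^t* = diag_mx q.
    by apply: real_diag_mx_adj => i; rewrite !mxE ger0_real // sqrtC_ge0 mulr_ge0 // sqrtC_ge0.
  have qq : diag_mx (s a) *m diag_mx (s b) = diag_mx q *m (diag_mx q) ^t*.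
    rewrite q_adj !mulmx_diag; congr diag_mx; apply/rowP => i.
    by rewrite !mxE -expr2 sqrtCK.
  have := psd_congr (U ^t* *m diag_mx q) (psd1 n).
  by rewrite mulmx1 mulU qq.
- rewrite AE BE !mulmxA -!(mulmxA _ U) (unitarymxP Uu) !mulmx1.
  rewrite -!(mulmxA (U ^t*)); congr (_ *m (_ *m _)).
  rewrite -[in RHS](ss a) -[in RHS](ss b) -!mulmxA; congr (_ *m _).
  by rewrite !mulmxA; congr (_ *m _); rewrite diag_mxC.
Qed.

End SumsOfCommutingPairs.

Theorem theorem2 (C : numClosedFieldType) (K d : nat)
  (A B : 'I_K -> 'M[C]_d) :
  (0 < K)%N -> (0 < d)%N ->
  (forall k, psdmx (A k)) -> (forall k, psdmx (B k)) ->
  (forall k, A k *m B k = B k *m A k) ->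
  weak_maj (singvals (\sum_(k < K) (A k *m B k)))
           (singvals ((\sum_(k < K) A k) *m (\sum_(k < K) B k))).
Proof.
move=> _ _ Apsd Bpsd AB.
have [RT RTP] := fin_all_exists (fun i => psd_commuting_factors (Apsd i) (Bpsd i) (AB i)).
split=> [|k]; rewrite !size_singvals // => kd.
pose X i := (RT i).1 *m (RT i).2 ^t*.
have Xpsd i : psdmx (X i) by have [] := RTP i.
have ABX : \sum_(i < K) A i *m B i = \sum_(i < K) X i *m X i.
  by apply: eq_bigr => i _; have [] := RTP i.
pose M := \sum_(i < K) X i *m X i.
have Mpsd : psdmx M.
  apply: psd_sum => i.
  have := psd_congr (X i) (psd1 C d); by rewrite mulmx1 (herm_adj (Xpsd i).1).
have [U [w [_ [Uu ME _ _ _]]]] :=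
  herm_codiag (herm_adj Mpsd.1) (herm_adj Mpsd.1) (erefl _).
have w0 : forall i, 0 <= w 0 i by apply: (psd_diag_ge0 Uu); rewrite -ME.
(* As [M] is positive semidefinite, [M^* M = M^2] and its singular values are its own
   eigenvalues. *)
have MM : M ^t* *m M = U ^t* *m diag_mx (\row_i w 0 i ^+ 2) *m U.
  by rewrite (herm_adj Mpsd.1) ME diag_conj_sqr.
have w20 i : 0 <= (\row_i w 0 i ^+ 2 : 'rV[C]_d) 0 i by rewrite mxE exprn_ge0.
rewrite ABX (sort_dec_singvals Uu w20 MM).
have -> : [seq sqrtC ((\row_i w 0 i ^+ 2 : 'rV[C]_d) 0 i) | i : 'I_d] =
          [seq w 0 i | i : 'I_d].
  by apply: eq_map => i; rewrite mxE sqrCK.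
have [J [Jk -> _]] := sort_dec_top w0 kd.
have [V [l [Vu VM lF _]]] := spectral_rows w J Uu.
have -> : \sum_(i in J) w 0 i = \tr (V *m M *m V ^t*).
  by rewrite ME VM -mulmxA (unitarymxP Vu) mulmx1 mxtrace_diag (lF id).
pose R := \mxrow_(i < K) (RT i).1; pose T := \mxrow_(i < K) (RT i).2.
have adj_row (F : 'I_K -> 'M[C]_d) : (\mxrow_i F i) ^t* = \mxcol_i (F i) ^t*.
  by apply/matrixP => i j; rewrite !mxE.
have RR : R *m R ^t* = \sum_(i < K) A i.
  by rewrite adj_row mul_mxrow_mxcol; apply: eq_bigr => i _; have [] := RTP i.
have TT : T *m T ^t* = \sum_(i < K) B i.
  by rewrite adj_row mul_mxrow_mxcol; apply: eq_bigr => i _; have [] := RTP i.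
have RTX : R *m T ^t* = \sum_(i < K) X i by rewrite adj_row mul_mxrow_mxcol.
(* The signed sums start from [H = G = 0], so the condition on the bound concerns only the square of
   the full sum of the [X i]. *)
have := @trace_sum_sqr_le C d _ (index_enum 'I_K) X #|J|
  (\sum_(j < k) (sort_dec (singvals ((\sum_(i < K) A i) *m (\sum_(i < K) B i))))`_j)
  0 0 Xpsd (psd0 C d).1 (psd0 C d).1.
rewrite mulmx0 !add0r oppr0; apply=> //; try by apply: (psd0 C d).2.
move=> W Wu /=; rewrite -RR -TT -RTX; apply: trace_sqr_le_singvals => //.
  by rewrite RTX; apply: (psd_sum _ Xpsd).1.
by rewrite Jk leqnn.
Qed.
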